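(* There exists a universal constant $c$ such that for every finite simple claw-free graph $G$ with maximum degree $\Delta\geq 2$, $\mathrm{lcc}(G)\leq c\,\frac{\Delta}{\log\Delta}$.
   Context: A graph is claw-free if it has no induced subgraph isomorphic to $K_{1,3}$. A clique covering of a graph $G$ is a family $\mathcal{C}$ of cliques of $G$ such that every edge of $G$ is contained in at least one clique of $\mathcal{C}$; it is a $k$-clique covering if every vertex belongs to at most $k$ cliques of $\mathcal{C}$. $\mathrm{lcc}(G)$ is the smallest $k$ such that $G$ admits a $k$-clique covering. Logarithms are base $2$. *)

(* Defs.v *)
From HB Require Import structures.
From mathcomp Require Import all_boot all_order all_algebra.
From mathcomp Require Import reals exp.

Set Implicit Arguments.
Unset Strict Implicit.
Unset Printing Implicit Defensive.

Import Order.TTheory GRing.Theory Num.Theory.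

Record sgraph := SGraph {
  vertex :> finType;
  edge : rel vertex;
  edge_sym : symmetric edge;
  edge_irrefl : irreflexive edge }.

Arguments edge {s} x y.

Definition graph_iso (G H : sgraph) : Prop :=
  exists2 f : G -> H, bijective f & {mono f : x y / edge x y}.

Section Induced.
Variables (G : sgraph) (S : {set G}).

Definition induced_edge : rel {x : G | x \in S} :=
  fun x y => edge (val x) (val y).

Lemma induced_edge_sym : symmetric induced_edge.
Proof. by move=> x y; apply: edge_sym. Qed.

Lemma induced_edge_irrefl : irreflexive induced_edge.
Proof. by move=> x; apply: edge_irrefl. Qed.

Definition induced : sgraph := SGraph induced_edge_sym induced_edge_irrefl.
End Induced.

Section CompleteBipartite.
Variables m n : nat.

Definition bip_edge : rel ('I_m + 'I_n)%type :=
  fun x y => match x, y with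
             | inl _, inr _ | inr _, inl _ => true
             | _, _ => false
             end.

Lemma bip_edge_sym : symmetric bip_edge.
Proof. by case=> x; case. Qed.

Lemma bip_edge_irrefl : irreflexive bip_edge.
Proof. by case. Qed.

Definition complete_bipartite : sgraph := SGraph bip_edge_sym bip_edge_irrefl.
End CompleteBipartite.

Definition claw_free (G : sgraph) : Prop :=
  ~ exists S : {set G}, graph_iso (induced S) (complete_bipartite 1 3).

Section LocalCliqueCover.
Variable G : sgraph.

Definition degree (x : G) : nat := #|[set y | edge x y]|.

(* The graph without vertices has maximum degree 0. *)
Definition max_degree : nat := \max_(x : G) degree x.

Definition is_clique (C : {set G}) : bool :=
  [forall x in C, forall y in C, (x != y) ==> edge x y].

Definition clique_covering (F : {set {set G}}) : bool :=
  [forall C in F, is_clique C] &&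
  [forall x, forall y, edge x y ==> [exists C in F, (x \in C) && (y \in C)]].

Definition k_clique_covering (k : nat) (F : {set {set G}}) : bool :=
  clique_covering F && [forall x, #|[set C in F | x \in C]| <= k].

Lemma k_clique_covering_exists : exists k, [exists F, k_clique_covering k F].
Proof.
exists #|{set G}|; apply/existsP; exists [set C | is_clique C].
apply/andP; split; last by apply/forallP=> x; apply: max_card.
apply/andP; split; first by apply/forall_inP=> C; rewrite inE.
apply/forallP=> x; apply/forallP=> y; apply/implyP=> xy.
apply/existsP; exists [set x; y]; rewrite !inE !eqxx orbT !andbT.
apply/forall_inP=> u; rewrite !inE => /orP[]/eqP->;
  apply/forall_inP=> v; rewrite !inE => /orP[]/eqP->;
  by rewrite ?eqxx // ?(edge_sym y x) xy implybT.
Qed.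

Definition lcc : nat := ex_minn k_clique_covering_exists.
End LocalCliqueCover.

Definition log2 (R : realType) (x : R) : R := (ln x / ln 2)%R.

(* Main.v *)
(** Fix a maximal independent set R.  By claw-freeness every vertex v has one or
two closed neighbours in R, its dominators.  Call an edge far if its ends have no
common dominator.  A vertex with a far edge has a single dominator, and its far
neighbours form a clique; hence the maximal cliques of single-dominator vertices
that meet at least three domination classes are pairwise disjoint.  Using these
costs one clique per vertex.

Every other edge uv has an end u and a dominator y of u such that v is served by
y, where v is served by its dominators and, if all its far neighbours lie in one
class, by the dominator of that class: at most two in all.  For each y, as in the
Erdos-Pyber theorem, partition the closed neighbourhood of y into cliques P of
size at most m by Ramsey's bound R(3, m) <= m ^ 2, sort the vertices v served by
y according to the trace S of their neighbourhood on P, and partition those with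
trace S <> set0, which all lie in the neighbourhood of any s in S, into cliques Q
of size at most k.  The cliques S :|: Q cover the edges in question.  A vertex
lies in one Q for each pair (y, P), and in S for one P for each y, with at most
2 ^ m traces.  For maximum degree D, taking m = a + 1 and k = 4 ^ a with a about
(log D) / 8 balances the two counts. *)
Require Import Defs.
From HB Require Import structures.
From mathcomp Require Import all_boot all_order all_algebra.
From mathcomp Require Import zify ring.
From mathcomp Require Import reals exp.

Set Implicit Arguments.
Unset Strict Implicit.
Unset Printing Implicit Defensive.

Import Order.TTheory GRing.Theory Num.Theory.

(** * Closed adjacency, Ramsey's bound and partitions into cliques *)

Section ClosedAdjacency.
Variable G : sgraph.
Implicit Types (x y : G) (X C : {set G}).

Definition cadj x y := (x == y) || edge x y.

Lemma cadj_refl x : cadj x x. Proof. by rewrite /cadj eqxx. Qed.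

Lemma cadj_sym x y : cadj x y = cadj y x.
Proof. by rewrite /cadj eq_sym edge_sym. Qed.

Lemma edge_cadj x y : edge x y -> cadj x y.
Proof. by rewrite /cadj orbC => ->. Qed.

Lemma cadj_edge x y : x != y -> cadj x y -> edge x y.
Proof. by rewrite /cadj => /negPf->. Qed.

Lemma is_cliqueP C : reflect {in C &, forall x y, cadj x y} (is_clique C).
Proof.
apply: (iffP forall_inP) => [cC x y xC yC | cC x xC].
  by move/forall_inP: (cC x xC) => /(_ y yC); rewrite /cadj; case: eqP.
by apply/forall_inP => y yC; have := cC x y xC yC; rewrite /cadj; case: eqP.
Qed.

Lemma is_cliqueS C1 C2 : C1 \subset C2 -> is_clique C2 -> is_clique C1.
Proof.
move=> /subsetP sC /is_cliqueP cC; apply/is_cliqueP => x y xC yC.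
exact: cC (sC _ xC) (sC _ yC).
Qed.

(** Independence number at most two: [cadj] is reflexive, so triples with a repetition pass
    automatically. *)
Definition alpha2 X := forall x y z, x \in X -> y \in X -> z \in X ->
  [|| cadj x y, cadj x z | cadj y z].

Lemma alpha2S X1 X2 : X1 \subset X2 -> alpha2 X2 -> alpha2 X1.
Proof. by move=> /subsetP sX aX x y z xX yX zX; apply: aX; apply: sX. Qed.

Lemma subset_of_card X n : n <= #|X| -> exists2 C : {set G}, C \subset X & #|C| = n.
Proof.
move=> le_nX; exists [set x | x \in take n (enum X)].
  by apply/subsetP => x; rewrite inE => /mem_take; rewrite mem_enum.
rewrite cardsE (card_uniqP _) ?take_uniq ?enum_uniq //.
by rewrite size_takel // -cardE.
Qed.

(** In the step to [m.+1], the non-neighbours of a vertex [v] form a clique. Either more than [m] of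
    them exist, or at least [m ^ 2] neighbours of [v] remain and a clique of size [m] among them
    extends by [v]. *)
Lemma ramsey3 m X : alpha2 X -> m ^ 2 <= #|X| ->
  exists C : {set G}, [/\ C \subset X, is_clique C & #|C| = m].
Proof.
elim: m X => [|m IHm] X aX leX.
  exists set0; rewrite sub0set cards0; split=> //.
  by apply/is_cliqueP => x y; rewrite inE.
have [v vX] : exists v, v \in X by apply/card_gt0P; lia.
pose Nv := [set u in X | edge v u]; pose Fv := [set u in X | ~~ cadj v u].
have cFv : is_clique Fv.
  apply/is_cliqueP => x y; rewrite !inE => /andP[xX /negPf nx] /andP[yX /negPf ny].
  by have := aX v x y vX xX yX; rewrite nx ny.
have [leF|ltF] := leqP m.+1 #|Fv|.
  have [C sCF cardC] := subset_of_card leF.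
  exists C; split=> //; last exact: is_cliqueS sCF cFv.
  by apply: subset_trans sCF _; apply/subsetP => x; rewrite inE => /andP[].
have cardX : #|X| <= 1 + #|Nv| + #|Fv|.
  have /subset_leq_card/leq_trans : X \subset ([set v] :|: Nv) :|: Fv.
    apply/subsetP => x xX; rewrite !inE xX /cadj eq_sym /=.
    by case: eqP => //=; case: edge.
  apply; apply: leq_trans (leq_card_setU _ _) _; rewrite leq_add2r.
  by apply: leq_trans (leq_card_setU _ _) _; rewrite cards1.
have sNX : Nv \subset X by apply/subsetP => x; rewrite inE => /andP[].
have [|C [sCN cC cardC]] := IHm Nv (alpha2S sNX aX); first by nia.
have vC : v \notin C.
  by apply/negP => /(subsetP sCN); rewrite inE edge_irrefl andbF.
exists (v |: C); rewrite cardsU1 vC cardC subUset sub1set vX (subset_trans sCN) //.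
split=> //; apply/is_cliqueP => x y; rewrite !inE.
have adjv z : z \in C -> cadj v z.
  by move/(subsetP sCN); rewrite inE => /andP[_ /edge_cadj].
move=> /predU1P[->|xC] /predU1P[->|yC]; rewrite ?cadj_refl ?adjv //.
  by rewrite cadj_sym adjv.
by move/is_cliqueP: cC; apply.
Qed.

(** A partition into cliques, encoded by the part number of each vertex. *)
Definition clique_coloring m n X (f : G -> nat) :=
  [/\ {in X, forall x, f x < n},
      {in X &, forall x y, f x = f y -> cadj x y} &
      forall i, #|[set x in X | f x == i]| <= m].

(** Greedy: as long as [m ^ 2] vertices remain, [ramsey3] removes a clique of exactly [m], lowering
    [#|X| %/ m] by one; the fewer than [m ^ 2] vertices left become singletons. *)
Lemma clique_coloring_exists m X : 0 < m -> alpha2 X ->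
  exists f, clique_coloring m (#|X| %/ m + m ^ 2) X f.
Proof.
move=> m_gt0; have [n] := ubnP #|X|; elim: n X => // n IHn X leXn aX.
have [leX|ltX] := leqP (m ^ 2) #|X|; last first.
  exists (fun x => index x (enum X)).
  have inj x y : x \in X -> y \in X ->
      index x (enum X) = index y (enum X) -> x = y.
    by move=> xX yX; apply: (index_inj x); rewrite mem_enum.
  split=> [x xX | x y xX yX /inj-> // | i]; last 1 first.
  - apply: leq_trans m_gt0; apply/card_le1_eqP => x y.
    rewrite !inE => /andP[xX /eqP ix] /andP[yX /eqP iy].
    by apply: inj; rewrite // ix iy.
  - have : index x (enum X) < size (enum X) by rewrite index_mem mem_enum.
    by rewrite -cardE => /leq_trans->//; apply: leq_trans (ltnW ltX) (leq_addl _ _).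
  exact: cadj_refl.
have [C [sCX cC cardC]] := ramsey3 aX leX.
have cardD : #|X :\: C| = #|X| - m by rewrite cardsD (setIidPr sCX) cardC.
have le_mX : m <= #|X| by rewrite -cardC subset_leq_card.
have [||f [f_lt f_adj f_card]] := IHn (X :\: C).
- by lia.
- exact: alpha2S (subsetDl _ _) aX.
pose N := #|X :\: C| %/ m + m ^ 2.
have -> : #|X| %/ m + m ^ 2 = N.+1.
  by rewrite /N cardD -{1}(subnK le_mX) divnDr ?dvdnn // divnn m_gt0 addn1 addSn.
exists (fun x => if x \in C then N else f x); split=> [x xX | x y xX yX | i].
- by case: ifP => // xC; rewrite ltnS ltnW // f_lt // inE xC.
- case: ifP => xC; case: ifP => yC; first by move/is_cliqueP: cC => ->.
  + by move=> E; have := f_lt y; rewrite inE yC yX -E ltnn => /(_ isT).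
  + by move=> E; have := f_lt x; rewrite inE xC xX E ltnn => /(_ isT).
  + by apply: f_adj; rewrite inE ?xC ?yC.
have [->|neq_iN] := eqVneq i N.
  rewrite -cardC subset_leq_card //; apply/subsetP => x; rewrite inE.
  case: ifP => //= xC /andP[xX /eqP fx].
  by have := f_lt x; rewrite inE xC xX fx ltnn => /(_ isT).
apply: leq_trans (f_card i); rewrite subset_leq_card //; apply/subsetP => x.
by rewrite !inE; case: (x \in C) => //; rewrite eq_sym (negPf neq_iN) andbF.
Qed.

End ClosedAdjacency.

(** * Claws and maximal independent sets *)

Lemma claw_freeP (G : sgraph) (x a b c : G) : claw_free G ->
  edge x a -> edge x b -> edge x c -> [|| cadj a b, cadj a c | cadj b c].
Proof.
move=> cf xa xb xc; apply: contra_notT cf; rewrite !negb_or => /and3P[].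
move=> /andP[nab eab] /andP[nac eac] /andP[nbc ebc].
have neq_x y : edge x y -> x != y.
  by apply: contraTneq => ->; rewrite edge_irrefl.
have [[nxa nxb] nxc] := (neq_x _ xa, neq_x _ xb, neq_x _ xc).
pose S := [set x; a; b; c]; exists S.
pose f (v : induced S) : complete_bipartite 1 3 :=
  if val v == x then inl ord0 else
  if val v == a then inr (inord 0) else
  if val v == b then inr (inord 1) else inr (inord 2).
pose h (w : complete_bipartite 1 3) : G :=
  match w with inl _ => x
             | inr i => if i == 0 :> nat then a else if i == 1 :> nat then b else c end.
have hS w : h w \in S.
  by case: w => [i|i]; rewrite !inE /=; [|case: ifP => _; [|case: ifP => _]]; rewrite eqxx ?orbT.
have E := (eqxx, negPf nxa, negPf nxb, negPf nxc, negPf nab, negPf nac, negPf nbc,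
           (eq_sym a x), (eq_sym b x), (eq_sym c x), (eq_sym b a), (eq_sym c a), (eq_sym c b)).
exists f.
  exists (fun w => Sub (h w) (hS w)).
    case=> v vS; apply: val_inj; rewrite /= /f /=; have : v \in S := vS; rewrite !inE.
    move=> /orP[/orP[/orP[]|]|] /eqP->; rewrite ?E /= ?E /= ?E /=; rewrite ?inordK //.
  case=> [i|i]; rewrite /f /=; first by rewrite eqxx; congr inl; apply: val_inj; case: i => [[|i]].
  case: i => [[|[|[|i]]] lti] //=; rewrite ?E /= ?E /= ?E /=;
    by congr inr; apply: val_inj; rewrite /= inordK.
case=> u uS [v vS]; rewrite /f /= /induced_edge /=.
have : u \in S := uS; have : v \in S := vS; rewrite !inE.
have E2 := (xa, xb, xc, negPf eab, negPf eac, negPf ebc, edge_irrefl,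
  (edge_sym a x), (edge_sym b x), (edge_sym c x), (edge_sym b a), (edge_sym c a), (edge_sym c b)).
by move=> /orP[/orP[/orP[]|]|] /eqP ev /orP[/orP[/orP[]|]|] /eqP eu;
  rewrite eu ev; rewrite ?E /= ?E /= ?E /=; rewrite ?E2.
Qed.

Lemma maximal_independent_exists (G : sgraph) : exists R : {set G},
  {in R &, forall x y, cadj x y -> x = y} /\
  forall v, exists2 y, y \in R & cadj v y.
Proof.
pose indep (R : {set G}) := [forall x in R, forall y in R, cadj x y ==> (x == y)].
have indepP (R : {set G}) : reflect {in R &, forall x y, cadj x y -> x = y} (indep R).
  apply: (iffP forall_inP) => [iR x y xR yR xy | iR x xR].
    by move/forall_inP: (iR x xR) => /(_ y yR); rewrite xy => /eqP.
  by apply/forall_inP => y yR; apply/implyP => /(iR x y xR yR)/eqP.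
have [|R maxR] := @ex_maxset _ indep.
  by exists set0; apply/indepP => x y; rewrite inE.
have /indepP iR := maxsetp maxR; exists R; split=> // v.
apply/exists_inP; apply: contraT => /exists_inPn nv.
suff E : v |: R = R by have := nv v; rewrite -E setU11 cadj_refl => /(_ isT).
apply: (maxsetsup maxR); last exact: subsetUr.
apply/indepP => x y; rewrite !inE.
move=> /predU1P[->|xR] /predU1P[->|yR] // xy; last exact: iR.
  by have := nv y yR; rewrite xy.
by have := nv x xR; rewrite cadj_sym xy.
Qed.

(** * Dominators, far edges and big cliques *)

Section Dominators.
Variables (G : sgraph) (R : {set G}).
Hypothesis claw_freeG : claw_free G.
Hypothesis R_indep : {in R &, forall x y, cadj x y -> x = y}.
Hypothesis R_dom : forall v, exists2 y, y \in R & cadj v y.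
Implicit Types (u v w x y z : G) (M : {set G}).

Definition dom v : {set G} := [set y in R | cadj v y].

Lemma dom_card_gt0 v : 0 < #|dom v|.
Proof. by have [y yR vy] := R_dom v; apply/card_gt0P; exists y; rewrite inE yR. Qed.

(** Three pairwise non-adjacent members would all differ from [y], which is adjacent to the others,
    and so form a claw at [y]. *)
Lemma alpha2_closed_nbhd y : alpha2 [set v | cadj v y].
Proof.
move=> a b c; rewrite !inE => ay cy dy; apply: contraT => /norP[nab /norP[nac nbc]].
have edge_y p q : cadj p y -> cadj q y -> ~~ cadj p q -> edge y p.
  move=> py qy npq; rewrite edge_sym cadj_edge //.
  by apply: contraNneq npq => ->; rewrite cadj_sym.
have := claw_freeP claw_freeG (edge_y a b ay cy nab) (edge_y b c cy dy nbc).
move=> /(_ c); rewrite (negPf nab) (negPf nac) (negPf nbc); apply.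
by apply: edge_y dy cy _; rewrite cadj_sym.
Qed.

Lemma dom_card_le2 v : #|dom v| <= 2.
Proof.
rewrite leqNgt; apply/card_gt2P => -[x] [y] [z] [[]]; rewrite !inE.
move=> /andP[xR vx] /andP[yR vy] /andP[zR vz] [nxy nyz nzx].
have := @alpha2_closed_nbhd v x y z; rewrite !inE !(cadj_sym _ v) => /(_ vx vy vz).
by case/or3P => /R_indep E; move: nxy nyz nzx; rewrite E ?eqxx.
Qed.

Definition far u v := edge u v && [disjoint dom u & dom v].

Lemma far_sym u v : far u v = far v u.
Proof. by rewrite /far edge_sym disjoint_sym. Qed.

Lemma far_edge u v : far u v -> edge u v.
Proof. by case/andP. Qed.

Lemma far_dom v u y : far v u -> y \in dom v -> edge v y /\ ~~ cadj y u.
Proof.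
move=> /andP[vu duv] yv; have := disjointFr duv yv.
have : y \in dom v := yv; rewrite !inE => /andP[yR vy].
rewrite yR cadj_sym /= => ->; split=> //; apply: cadj_edge => //.
apply: contraTneq vu => E; have := disjointFr duv yv.
by rewrite inE yR -E => /negbT; apply: contra => /edge_cadj; rewrite cadj_sym.
Qed.

(** A dominator of [v] is adjacent to [v] but to neither far neighbour, so distinct non-adjacent [u]
    and [w] would complete a claw at [v]. *)
Lemma far_cadj v u w : far v u -> far v w -> cadj u w.
Proof.
move=> vu vw; have /card_gt0P[y yv] := dom_card_gt0 v.
have [vy /negPf nyu] := far_dom vu yv; have [_ /negPf nyw] := far_dom vw yv.
by have := claw_freeP claw_freeG vy (far_edge vu) (far_edge vw); rewrite nyu nyw.
Qed.

(** Two dominators of [v] and the far neighbour [u] would form a claw at [v]. *)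
Lemma far_card_dom v u : far v u -> #|dom v| = 1.
Proof.
move=> vu; apply/eqP; rewrite eqn_leq dom_card_gt0 andbT.
apply/card_le1_eqP => y z yv zv.
have [vy /negPf nyu] := far_dom vu yv; have [vz /negPf nzu] := far_dom vu zv.
have := claw_freeP claw_freeG vy vz (far_edge vu); rewrite nyu nzu !orbF.
by move: yv zv; rewrite !inE => /andP[yR _] /andP[zR _] /R_indep->.
Qed.

Definition uniq_dom : {set G} := [set v | #|dom v| == 1].

Lemma far_dom_neq u v : far u v -> dom u != dom v.
Proof.
case/andP=> _ duv; apply: contraTneq duv => ->.
have /card_gt0P[y yv] := dom_card_gt0 v.
by apply/pred0Pn; exists y; rewrite /= yv.
Qed.

Lemma dom_neq_far u v : u \in uniq_dom -> v \in uniq_dom ->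
  cadj u v -> dom u != dom v -> far u v.
Proof.
rewrite !inE => /cards1P[y du] /cards1P[z dv] uv nuv.
rewrite /far du dv disjoints1 inE cadj_edge //=; last first.
  by apply: contraNneq nuv => ->.
by apply: contraNneq nuv => E; rewrite du dv E.
Qed.

Definition big_clique M := [&& is_clique M, M \subset uniq_dom &
  [exists a in M, exists b in M, exists c in M,
    [&& dom a != dom b, dom a != dom c & dom b != dom c]]].

(** This is what the three classes in [big_clique] are for: any two classes can be dodged. *)
Lemma big_clique_avoid M (D1 D2 : {set G}) : big_clique M ->
  exists2 u, u \in M & (dom u != D1) && (dom u != D2).
Proof.
case/and3P=> _ _ /exists_inP[a aM] /exists_inP[b bM] /exists_inP[c cM].
move=> /and3P[nab nac nbc].
have [ea|] := boolP ((dom a != D1) && (dom a != D2)); first by exists a.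
have [eb|] := boolP ((dom b != D1) && (dom b != D2)); first by exists b.
rewrite !negb_and !negbK => eb ea; exists c => //.
by case/orP: ea nab nac => /eqP->; case/orP: eb nbc => /eqP->;
  rewrite ?eqxx // !(eq_sym (dom c)) => -> // _ ->.
Qed.

(** To join [y] to [z], find a vertex far from both and apply [far_cadj]. The shared [x] works when
    neither lies in its class; otherwise [big_clique_avoid] supplies a substitute. *)
Lemma big_clique_cadj M1 M2 x : big_clique M1 -> big_clique M2 ->
  x \in M1 -> x \in M2 -> {in M1 & M2, forall y z, cadj y z}.
Proof.
have half N1 N2 : big_clique N1 -> big_clique N2 -> x \in N1 -> x \in N2 ->
    forall y z, y \in N1 -> z \in N2 -> dom y != dom x -> cadj y z.
  move=> b1 b2 xN1 xN2 y z yN1 zN2 nyx.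
  have [/is_cliqueP c1 /subsetP s1 _] := and3P b1.
  have [/is_cliqueP c2 /subsetP s2 _] := and3P b2.
  have xy : far x y by apply: dom_neq_far; rewrite ?s1 ?c1 // eq_sym.
  have [ezx|nzx] := eqVneq (dom z) (dom x); last first.
    by apply: (far_cadj xy); apply: dom_neq_far; rewrite ?s2 ?c2 // eq_sym.
  (* Here [z] shares the class of [x]. The new [u] is far from [x], hence adjacent to [y], and its
     class makes it far from both [y] and [z]. *)
  have [u uN2 /andP[nux nuy]] := big_clique_avoid (dom x) (dom y) b2.
  have xu : far x u by apply: dom_neq_far; rewrite ?s2 ?c2 // eq_sym.
  have uy : far u y by apply: dom_neq_far; rewrite ?(s2 u) ?(s1 y) ?(far_cadj xu xy) //.
  apply: (far_cadj uy); apply: dom_neq_far; rewrite ?s2 ?c2 //.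
  by rewrite ezx.
move=> b1 b2 x1 x2 y z y1 z2.
have [eyx|] := eqVneq (dom y) (dom x); last exact: half b1 b2 x1 x2 _ _ y1 z2.
have [ezx|] := eqVneq (dom z) (dom x); last first.
  by rewrite cadj_sym; apply: half b2 b1 x2 x1 _ _ z2 y1.
have [u uM1 /andP[nux _]] := big_clique_avoid (dom x) (dom x) b1.
have [/is_cliqueP c1 /subsetP s1 _] := and3P b1.
have [_ /subsetP s2 _] := and3P b2.
have uy : far u y by apply: dom_neq_far; rewrite ?s1 ?c1 // eyx.
have uz := half _ _ b1 b2 x1 x2 _ _ uM1 z2 nux.
by apply: (far_cadj uy); apply: dom_neq_far; rewrite ?(s1 u) ?(s2 z) // ezx.
Qed.

(** The union of two intersecting big cliques is big, so each maximal one equals it. *)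
Lemma maxset_big_clique_eq M1 M2 x : maxset big_clique M1 ->
  maxset big_clique M2 -> x \in M1 -> x \in M2 -> M1 = M2.
Proof.
move=> m1 m2 x1 x2; have [b1 b2] := (maxsetp m1, maxsetp m2).
suff bU : big_clique (M1 :|: M2).
  rewrite -(maxsetsup m1 bU (subsetUl _ _)).
  exact: maxsetsup m2 bU (subsetUr _ _).
have adj := big_clique_cadj b1 b2 x1 x2.
have [/is_cliqueP c1 s1 ex1] := and3P b1; have [/is_cliqueP c2 s2 _] := and3P b2.
apply/and3P; split; last 1 first.
- move: ex1 => /exists_inP[a aM] /exists_inP[b bM] /exists_inP[c cM] nabc.
  apply/exists_inP; exists a; rewrite ?inE ?aM //.
  apply/exists_inP; exists b; rewrite ?inE ?bM //.
  by apply/exists_inP; exists c; rewrite ?inE ?cM.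
- apply/is_cliqueP => y z; rewrite !inE.
  move=> /orP[y1|y2] /orP[z1|z2]; last exact: c2.
  + exact: c1.
  + exact: adj.
  + by rewrite cadj_sym; apply: adj.
- by rewrite subUset s1.
Qed.

(* Besides its dominators, a vertex whose far neighbours all lie in one class
   is served by the dominator of that class. *)
Definition centers v := dom v :|:
  [set y | [exists u, far v u] && [forall u, far v u ==> (y \in dom u)]].

Lemma centers_sub v : centers v \subset R.
Proof.
apply/subsetP => y; rewrite in_setU => /orP[|]; first by rewrite inE => /andP[].
rewrite inE => /andP[/existsP[u vu] /forallP/(_ u)].
by rewrite vu inE => /andP[].
Qed.

(** With a far neighbour [u], [dom v] is a singleton and any further center lies in the singleton
    [dom u]; without one, only the dominators remain. *)
Lemma card_centers_le2 v : #|centers v| <= 2.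
Proof.
rewrite /centers; case: (boolP [exists u, far v u]) => [/existsP[u vu] | nvu].
  apply: leq_trans (leq_card_setU _ _) _.
  rewrite (far_card_dom vu) ltnS -(@far_card_dom u v) ?(far_sym u) //.
  apply: subset_leq_card; apply/subsetP => y; rewrite [in X in X -> _]inE /=.
  by move=> /forallP/(_ u); rewrite vu.
by rewrite (_ : [set _ | _] = set0) ?setU0 ?dom_card_le2 //.
Qed.

(** On a far edge, if [v] has a far neighbour [w] outside the class of [u], then [u], [v], [w] form
    a triangle meeting three classes; otherwise the dominator of [u] serves [v]. On other edges a
    common dominator does. *)
Lemma edge_center_or_big u v : edge u v ->
  (exists y, (y \in dom u) && (y \in centers v)) \/
  exists2 M, maxset big_clique M & (u \in M) && (v \in M).
Proof.
move=> uv; have [/(conj uv)/andP uv_far | ] := boolP [disjoint dom u & dom v].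
  have vu_far : far v u by rewrite far_sym.
  have [[w vw nwu] | same] : (exists2 w, far v w & dom w != dom u) \/
      (forall w, far v w -> dom w = dom u).
    case: (boolP [exists w, far v w && (dom w != dom u)]).
      by case/existsP=> w /andP[]; left; exists w.
    move/existsPn=> same; right=> w vw; apply/eqP.
    by have := same w; rewrite vw negbK.
  - right; have bM : big_clique [set u; v; w].
      apply/and3P; split.
      + have := (edge_cadj uv, edge_cadj (far_edge vw), far_cadj vu_far vw).
        move=> [[cuv cvw] cuw]; apply/is_cliqueP => a b; rewrite !inE.
        by move=> /orP[/orP[]|] /eqP-> /orP[/orP[]|] /eqP->;
          rewrite ?cadj_refl ?cuv ?cvw ?cuw // cadj_sym.
      + apply/subsetP => a; rewrite !inE => /orP[/orP[]|] /eqP->.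
        * by rewrite (far_card_dom uv_far).
        * by rewrite (far_card_dom vu_far).
        * by rewrite (@far_card_dom w v) // far_sym.
      + apply/exists_inP; exists u; rewrite ?inE ?eqxx //.
        apply/exists_inP; exists v; rewrite ?inE ?eqxx ?orbT //.
        apply/exists_inP; exists w; rewrite ?inE ?eqxx ?orbT //.
        by rewrite (far_dom_neq uv_far) (far_dom_neq vw) eq_sym nwu.
    have [M maxM /subsetP sM] := maxset_exists bM; exists M => //.
    by rewrite !sM // !inE eqxx ?orbT.
  - left; have /card_gt0P[y yu] := dom_card_gt0 u; exists y.
    rewrite yu in_setU; apply/orP; right; rewrite inE; apply/andP; split.
      by apply/existsP; exists u.
    by apply/forallP => w; apply/implyP => /same->.
by case/pred0Pn=> y /andP[/= yu yv]; left; exists y; rewrite yu in_setU yv.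
Qed.

End Dominators.

(** * The clique covering and its local count *)

Lemma card_bigcup_le (I T : finType) (A : {set I}) (B : I -> {set T}) n :
  {in A, forall i, #|B i| <= n} -> #|\bigcup_(i in A) B i| <= #|A| * n.
Proof.
move=> leB; rewrite -sum_nat_const.
elim/big_rec2: _ => [|i s U iA leU]; first by rewrite cards0.
by apply: leq_trans (leq_card_setU _ _) _; rewrite leq_add ?leB.
Qed.

Section Cover.
Variables (G : sgraph) (m k : nat).
Hypotheses (claw_freeG : claw_free G) (m_gt0 : 0 < m) (k_gt0 : 0 < k).

Let nparts p := (max_degree G).+1 %/ p + p ^ 2.

Lemma card_closed_nbhd (y : G) : #|[set v | cadj v y]| <= (max_degree G).+1.
Proof.
apply: leq_trans (_ : #|y |: [set v | edge y v]| <= _).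
  apply: subset_leq_card; apply/subsetP => v; rewrite !inE.
  by rewrite /cadj edge_sym.
rewrite cardsU1 -add1n leq_add ?leq_b1 //.
exact: (leq_bigmax y).
Qed.

Lemma bounded_coloring_exists p (X : {set G}) : 0 < p -> alpha2 X ->
  #|X| <= (max_degree G).+1 -> exists f, clique_coloring p (nparts p) X f.
Proof.
move=> p_gt0 aX leX; have [f [f_lt f_adj f_card]] := clique_coloring_exists p_gt0 aX.
exists f; split=> // x /f_lt/leq_trans; apply.
by rewrite leq_add2r leq_div2r.
Qed.

(** The summands count the cliques at a vertex: maximal big cliques, cliques containing it in their
    Q, and cliques containing it in their trace S. *)
Lemma lcc_le_parts : lcc G <= 1 + 2 * nparts m + 2 * (2 ^ m * nparts k).
Proof.
have [R [R_indep R_dom]] := maximal_independent_exists G.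
pose N (v : G) : {set G} := [set w | cadj w v].
have aN v : alpha2 (N v) by apply: alpha2_closed_nbhd.
have [f f_col] : exists f : G -> G -> nat,
    forall y, clique_coloring m (nparts m) (N y) (f y).
  apply: (@fin_all_exists G (fun=> G -> nat) (fun y h => clique_coloring m (nparts m) (N y) h)).
  by move=> y; apply: bounded_coloring_exists m_gt0 (aN y) (card_closed_nbhd y).
pose P y i : {set G} := [set z in N y | f y z == i].
(* [p] is a vertex [y] with a candidate trace [S]. Ranging over all such pairs keeps the index type
   finite for [fin_all_exists], at the price of some empty [T p]. *)
pose T (p : G * {set G}) : {set G} :=
  [set v | [&& p.1 \in centers R v, p.2 != set0 &
               [exists i : 'I_(nparts m), p.2 == N v :&: P p.1 i]]].
have T_adj p v s : v \in T p -> s \in p.2 -> cadj v s.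
  rewrite inE => /and3P[_ _ /existsP[i /eqP->]].
  by rewrite !inE cadj_sym => /andP[].
(* A nonempty [T p] lies in the closed neighbourhood of any [s] in its trace. *)
have T_alpha2 p : alpha2 (T p) /\ #|T p| <= (max_degree G).+1.
  have [Tp0|/set0Pn[v0 v0T]] := eqVneq (T p) set0.
    by rewrite Tp0 cards0; split=> // x y z; rewrite inE.
  have /and3P[_ /set0Pn[s sS] _] : [&& p.1 \in centers R v0, p.2 != set0 &
     [exists i : 'I_(nparts m), p.2 == N v0 :&: P p.1 i]] by rewrite inE in v0T.
  have sT : T p \subset N s.
    by apply/subsetP => v vT; rewrite inE (T_adj p).
  split; first exact: alpha2S sT (aN s).
  exact: leq_trans (subset_leq_card sT) (card_closed_nbhd s).
have [g g_col] : exists g : G * {set G} -> G -> nat,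
    forall p, clique_coloring k (nparts k) (T p) (g p).
  apply: (@fin_all_exists (G * {set G})%type (fun=> G -> nat) (fun p h => clique_coloring k (nparts k) (T p) h)).
  by move=> p; have [aT cT] := T_alpha2 p; apply: bounded_coloring_exists.
pose B p j : {set G} := [set v in T p | g p v == j].
pose cl p j : {set G} := p.2 :|: B p j.
(* Requiring [B] nonempty makes [p.2] a genuine trace, hence contained in one part and a clique. *)
pose F : {set {set G}} := [set M | maxset (big_clique R) M] :|:
  [set cl t.1 t.2 | t : (G * {set G}) * 'I_(nparts k) & B t.1 t.2 != set0].
have F_clique C : C \in F -> is_clique C.
  rewrite in_setU inE => /orP[/maxsetp/and3P[] // | /imsetP[[p j]]].
  rewrite inE /= => /set0Pn[w]; rewrite inE => /andP[wT _] ->.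
  have : w \in T p := wT; rewrite inE => /and3P[_ _ /existsP[i /eqP pE]].
  have [_ f_adj _] := f_col p.1; have [_ g_adj _] := g_col p.
  have sP s : s \in p.2 -> s \in N p.1 /\ f p.1 s = i.
    by rewrite pE => /setIP[_]; rewrite inE => /andP[? /eqP].
  apply/is_cliqueP => x y; rewrite !in_setU ![_ \in B _ _]inE.
  move=> /orP[xS|/andP[xT /eqP xj]] /orP[yS|/andP[yT /eqP yj]].
  - by have [[xN xi] [yN yi]] := (sP x xS, sP y yS); apply: f_adj; rewrite ?xi.
  - by rewrite cadj_sym; apply: T_adj yT xS.
  - exact: T_adj xT yS.
  - by apply: g_adj; rewrite ?xj.
have F_cover u v : edge u v -> exists2 C, C \in F & (u \in C) && (v \in C).
  move=> uv; case: (edge_center_or_big claw_freeG R_indep R_dom uv) => [[y /andP[yu yv]] | [M maxM uvM]].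
    have uN : u \in N y by move: yu; rewrite !inE => /andP[].
    have [f_lt f_adj _] := f_col y; pose i := f y u.
    pose p := (y, N v :&: P y i).
    have uS : u \in p.2.
      by rewrite !inE /= (edge_cadj uv) eqxx andbT; move: uN; rewrite inE.
    have vT : v \in T p.
      rewrite inE; apply/and3P; split=> //; first by apply/set0Pn; exists u.
      by apply/existsP; exists (Ordinal (f_lt u uN)).
    have [g_lt _ _] := g_col p; have vB : v \in B p (g p v) by rewrite inE vT /=.
    exists (cl p (g p v)); last by rewrite !in_setU uS vB orbT.
    rewrite in_setU; apply/orP; right; apply/imsetP.
    exists (p, Ordinal (g_lt v vT)) => //; rewrite inE.
    by apply/set0Pn; exists v.
  by exists M => //; rewrite in_setU inE maxM.
have F_card v : #|[set C in F | v \in C]| <= 1 + 2 * nparts m + 2 * (2 ^ m * nparts k).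
  (* In [B1], [v] belongs to Q, so [y] and [i] determine both the trace and the colour. In [B2], [v]
     belongs to the trace, which is then a subset of the part of [v] in [N y]. *)
  pose B1 y : {set {set G}} :=
    [set (let S := N v :&: P y i in cl (y, S) (g (y, S) v)) | i : 'I_(nparts m)].
  pose B2 y : {set {set G}} :=
    [set cl (y, t.1) t.2 |
      t : {set G} * 'I_(nparts k) in setX (powerset (P y (f y v))) [set: 'I_(nparts k)]].
  pose F1 := [set M | maxset (big_clique R) M & v \in M].
  pose F2 := \bigcup_(y in centers R v) B1 y.
  pose F3 := \bigcup_(y in dom R v) B2 y.
  have F1_card : #|F1| <= 1.
    apply/card_le1_eqP => M1 M2; rewrite !inE => /andP[m1 v1] /andP[m2 v2].
    by rewrite (maxset_big_clique_eq claw_freeG R_dom m1 m2 v1 v2).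
  have F2_card : #|F2| <= 2 * nparts m.
    apply: leq_trans (leq_mul (card_centers_le2 claw_freeG R_indep R_dom v) (leqnn _)).
    apply: card_bigcup_le => y _; rewrite /B1.
    by apply: leq_trans (leq_imset_card _ _) _; rewrite cardT size_enum_ord.
  have F3_card : #|F3| <= 2 * (2 ^ m * nparts k).
    apply: leq_trans (leq_mul (dom_card_le2 claw_freeG R_indep v) (leqnn _)).
    apply: card_bigcup_le => y _; apply: leq_trans (leq_imset_card _ _) _.
    rewrite cardsX card_powerset cardsT card_ord leq_mul2r leq_exp2l //.
    by have [_ _ ->] := f_col y; rewrite orbT.
  have sF : [set C in F | v \in C] \subset (F1 :|: F2) :|: F3.
    apply/subsetP => C; rewrite inE in_setU => /andP[/orP[] + vC].
      by rewrite inE !in_setU [C \in F1]inE vC => ->.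
    case/imsetP=> [[p j]]; rewrite inE /= => /set0Pn[w]; rewrite inE.
    move=> /andP[wT _] EC; move: vC; rewrite EC in_setU.
    have : w \in T p := wT; rewrite inE => /and3P[pw _ /existsP[i /eqP pE]].
    case/orP=> [vS | vB]; rewrite !in_setU; apply/orP; [right | left; apply/orP; right].
      (* Centers lie in [R], so [p.1], whose closed neighbourhood contains [v], is a dominator of
         [v]. *)
      move: vS; rewrite pE => /setIP[_]; rewrite inE => /andP[vN /eqP vi].
      apply/bigcupP; exists p.1.
        by move: vN (subsetP (centers_sub R w) _ pw); rewrite !inE => -> ->.
      apply/imsetP; exists (p.2, j); last by rewrite /= -surjective_pairing.
      by rewrite !inE andbT /= pE vi subsetIr.
    move: vB; rewrite inE => /andP[vT /eqP <-].
    have : v \in T p := vT; rewrite inE => /and3P[pv _ /existsP[i' /eqP pE']].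
    apply/bigcupP; exists p.1 => //; apply/imsetP; exists i' => //.
    by rewrite /= -pE' -surjective_pairing.
  apply: leq_trans (subset_leq_card sF) _.
  apply: leq_trans (leq_card_setU _ _) (leq_add _ F3_card).
  exact: leq_trans (leq_card_setU _ _) (leq_add F1_card F2_card).
rewrite /lcc; case: ex_minnP => n _; apply.
apply/existsP; exists F; apply/andP; split; last exact/forallP.
apply/andP; split; first by apply/forall_inP.
apply/forallP => u; apply/forallP => v; apply/implyP => /F_cover[C CF uvC].
by apply/exists_inP; exists C.
Qed.
End Cover.

(* With x = 2 ^ a, the parameters m = a + 1 <= x and k = x ^ 2 are balanced
   against x ^ 8 <= D, and the four kinds of terms are O(D) once multiplied by m. *)
Lemma parts_bound D (L := trunc_log 2 D) (a := L %/ 8) : 0 < D ->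
  (1 + 2 * (D.+1 %/ a.+1 + a.+1 ^ 2) +
   2 * (2 ^ a.+1 * (D.+1 %/ 4 ^ a + (4 ^ a) ^ 2))) * L.+1 <= 152 * D.
Proof.
move=> D_gt0; have leL : L.+1 <= 8 * a.+1 by rewrite /a; lia.
set x := 2 ^ a; have -> : 4 ^ a = x ^ 2 by rewrite /x -expnM mulnC expnM.
rewrite [2 ^ a.+1]expnS -/x; set m := a.+1 in leL *.
have le_mx : m <= x by apply: ltn_expl.
have x_gt0 : 0 < x by rewrite expn_gt0.
have x8D : x ^ 8 <= D.
  apply: leq_trans (trunc_logP (isT : 1 < 2) D_gt0).
  by rewrite /x -expnM leq_exp2l // leq_trunc_div.
have xD i : i <= 8 -> x ^ i <= D.
  by move=> le_i8; apply: leq_trans x8D; rewrite leq_pexp2l.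
set q1 := D.+1 %/ m; set q2 := D.+1 %/ x ^ 2.
have q1m : q1 * m <= D.+1 by apply: leq_trunc_div.
have q2x : q2 * x ^ 2 <= D.+1 by apply: leq_trunc_div.
apply: leq_trans (leq_mul (leqnn _) leL) _.
have m3 : m ^ 3 <= D by apply: leq_trans (xD 3 isT); rewrite leq_exp2r.
have mxq : m * x * q2 <= D.+1.
  apply: leq_trans q2x; rewrite mulnC leq_mul2l; apply/orP; right.
  by rewrite -mulnn leq_mul2r le_mx orbT.
have mx5 : m * x ^ 5 <= D.
  by apply: leq_trans (xD 6 isT); rewrite expnS leq_mul2r le_mx orbT.
have m1 : m <= D by apply: leq_trans (xD 1 isT).
(* The bounds above add up to [104 * D + 48], at most [152 * D] as [D] is positive. *)
have -> : (1 + 2 * (q1 + m ^ 2) + 2 * (2 * x * (q2 + (x ^ 2) ^ 2))) * (8 * m) =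
  8 * m + 16 * (q1 * m) + 16 * m ^ 3 + 32 * (m * x * q2) + 32 * (m * x ^ 5).
  by rewrite -expnM; ring.
lia.
Qed.

(** * Passage to real logarithms *)

Local Open Scope ring_scope.

Theorem theorem2 (R : realType) :
  exists c : R, forall G : sgraph,
    claw_free G -> (2 <= max_degree G)%N ->
    (lcc G)%:R <= c * ((max_degree G)%:R / log2 (max_degree G)%:R).
Proof.
exists 152%:R => G claw_freeG; set D := max_degree G => D_ge2.
have D_gt0 : (0 < D)%N by apply: ltnW.
pose L := trunc_log 2 D; pose a := (L %/ 8)%N.
have lcc_le : (lcc G * L.+1 <= 152 * D)%N.
  apply: leq_trans (parts_bound D_gt0); rewrite leq_mul2r; apply/orP; right.
  by apply: (@lcc_le_parts G a.+1 (4 ^ a)); rewrite // expn_gt0.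
have ln2_gt0 : 0 < ln (2 : R) by rewrite ln_gt0 // ltr1n.
have lnD_gt0 : 0 < ln (D%:R : R) by rewrite ln_gt0 // ltr1n.
rewrite mulrA ler_pdivlMr ?divr_gt0 //.
(* Since [D < 2 ^ L.+1], the logarithm of [D] is at most [L.+1], and the bound over the naturals
   suffices. *)
apply: le_trans (_ : (lcc G * L.+1)%:R <= _); last by rewrite -natrM ler_nat.
rewrite natrM ler_wpM2l // /log2 ler_pdivrMr // mulr_natl -lnXn ?ltr0n //.
by rewrite ler_ln ?posrE ?exprn_gt0 ?ltr0n // -natrX ler_nat ltnW // trunc_log_ltn.
Qed.
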